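(* Let $A$ be a unital operator algebra, let $B\subset A$ be a unital subalgebra, and let $P : A\to A$ be a completely contractive unital linear projection ($P\circ P=P$) of $A$ onto $B$. Then $P$ is a conditional expectation in the sense that $$P(b_1\, a\, b_2) = b_1\, P(a)\, b_2 \qquad \text{for all } a\in A,\ b_1,b_2\in B.$$
   Context: An operator algebra is a norm-closed (not necessarily selfadjoint) algebra of operators on a Hilbert space, with its matrix norms; it is unital if it contains an identity of norm 1. A unital subalgebra is a (closed) subalgebra containing the identity of $A$. $P$ is unital if $P(1)=1$, and completely contractive if all amplifications $[a_{ij}]\mapsto[P(a_{ij})]$ on $n\times n$ matrices are contractive. *)

(* Defs.v *)
From HB Require Import structures.
From mathcomp Require Import all_boot all_order all_algebra.
From mathcomp Require Import all_classical all_reals all_analysis.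
From mathcomp Require Import complex.

Set Implicit Arguments.
Unset Strict Implicit.
Unset Printing Implicit Defensive.

Import Order.TTheory GRing.Theory Num.Theory.
Import numFieldNormedType.Exports.

Local Open Scope classical_set_scope.
Local Open Scope ring_scope.
Local Open Scope complex_scope.

(* Complex Hilbert spaces. The inner product is linear in its first argument
   and conjugate-linear in its second one. *)
HB.mixin Record CompleteNormedModule_isHilbert (R : realType) (H : Type)
    of CompleteNormedModule R[i] H := {
  hdot : {dot H for Num.conj} ;
  hdot_norm : forall x : H, `|x| ^+ 2 = hdot x x
}.

#[short(type="hilbertType")]
HB.structure Definition Hilbert (R : realType) :=
  {H of CompleteNormedModule R[i] H & CompleteNormedModule_isHilbert R H}.

Section OperatorAlgebras.
Variables (R : realType) (H : hilbertType R).

(* The norm of H takes its values in R[i]; this is the same number in R. *)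
Definition hnorm (x : H) : R := complex.Re `|x|.

(* B(H), as a subset of the module of all functions H -> H, which carries the
   pointwise addition and scaling; the product of operators is composition. *)
Definition bounded_operator : set (H -> H) :=
  [set T | linear T /\ continuous T].

(* On an unbounded function, sup returns 0; this is used on B(H) only. *)
Definition opnorm (T : H -> H) : R :=
  sup [set hnorm (T x) | x in [set x | hnorm x <= 1]].

Definition l2norm n (x : 'I_n -> H) : R :=
  Num.sqrt (\sum_(i < n) hnorm (x i) ^+ 2).

Definition mxapp n (a : 'M[H -> H]_n) (x : 'I_n -> H) : 'I_n -> H :=
  fun i => \sum_(j < n) a i j (x j).

(* The norm of M_n(B(H)) = B(H^n), where H^n is the Hilbert space direct sum. *)
Definition mxopnorm n (a : 'M[H -> H]_n) : R :=
  sup [set l2norm (mxapp a x) | x in [set x | l2norm x <= 1]].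

Record operator_algebra (A : set (H -> H)) : Prop := {
  opalg_bounded : A `<=` bounded_operator ;
  opalg0 : A 0 ;
  opalgD : forall S T, A S -> A T -> A (S + T) ;
  opalgZ : forall (k : R[i]) T, A T -> A (k *: T) ;
  opalgM : forall S T, A S -> A T -> A (S \o T) ;
  opalg_closed : forall T, bounded_operator T ->
    (forall eps : R, 0 < eps -> exists2 S, A S & opnorm (T - S) < eps) -> A T
}.

(* The identity e of A need not be the identity operator of H. *)
Record is_identity (A : set (H -> H)) (e : H -> H) : Prop := {
  identity_mem : A e ;
  identity_mull : forall T, A T -> e \o T = T ;
  identity_mulr : forall T, A T -> T \o e = T
}.

Record unital_operator_algebra (A : set (H -> H)) (e : H -> H) : Prop := {
  uopalg_opalg : operator_algebra A ;
  uopalg_identity : is_identity A e ;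
  uopalg_norm1 : opnorm e = 1
}.

Record unital_subalgebra (A : set (H -> H)) (e : H -> H) (B : set (H -> H)) :
    Prop := {
  usubalg_sub : B `<=` A ;
  usubalg_opalg : operator_algebra B ;
  usubalg_identity : B e
}.

(* Maps on an operator algebra A are total functions, of which only the
   restriction to A is considered. *)
Definition linear_on (A : set (H -> H)) (P : (H -> H) -> (H -> H)) : Prop :=
  forall (k : R[i]) S T, A S -> A T -> P (k *: S + T) = k *: P S + P T.

Definition completely_contractive (A : set (H -> H))
    (P : (H -> H) -> (H -> H)) : Prop :=
  forall n (a : 'M[H -> H]_n), (forall i j, A (a i j)) ->
    mxopnorm (map_mx P a) <= mxopnorm a.

End OperatorAlgebras.

(* Main.v *)
(** Replacing [a] by [a - P a], it suffices to show that [P x = 0] and [P b = b]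
    imply [P (b x) = 0] and [P (x b) = 0], for contractions [b] and [x]. Write
    [c = P (b x)]. If the row [(b, d c)] is a contraction, then the strictly upper
    triangular 3x3 matrix with entries [b], [(d^2 c + b x) / s], [- x / s], where
    [s^2 = d^2 + 1], has numerical range in the half plane [Re z <= 1/2]. As [P] is
    unital and completely contractive, the image matrix, with entries [b], [s c],
    [0], has the same property, which says that the row [(b, s c)] is a
    contraction. Iterating, [sqrt k c] is a contraction for every [k], so [c = 0].
    Columns are treated in the same way for [x b]. *)

Require Import Defs.
From HB Require Import structures.
From mathcomp Require Import all_boot all_order all_algebra.
From mathcomp Require Import all_classical all_reals all_analysis.
From mathcomp Require Import complex ring lra.

Set Implicit Arguments.
Unset Strict Implicit.
Unset Printing Implicit Defensive.

Import Order.TTheory GRing.Theory Num.Theory.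
Import numFieldNormedType.Exports.

Local Open Scope classical_set_scope.
Local Open Scope ring_scope.
Local Open Scope complex_scope.

(** * Real parts of complex numbers *)

Lemma Re_addC (R : realType) (a b : R[i]) :
  complex.Re (a + b) = complex.Re a + complex.Re b.
Proof. by case: a b => [? ?] [? ?]. Qed.

Lemma Re_oppC (R : realType) (a : R[i]) : complex.Re (- a) = - complex.Re a.
Proof. by case: a. Qed.

Lemma Re_scaleC (R : realType) (r : R) (a : R[i]) :
  complex.Re (r%:C * a) = r * complex.Re a.
Proof. by case: a => a b /=; rewrite mul0r subr0. Qed.

Lemma Re_conjC (R : realType) (a : R[i]) : complex.Re (a^*)%R = complex.Re a.
Proof. by case: a. Qed.

Section HilbertSpace.
Variables (R : realType) (H : hilbertType R).
Implicit Types (x y z : H) (r : R) (T : H -> H).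

(** Only norms and real parts of numerical values are estimated, so this real bilinear form replaces
    [hdot] and the estimates become real polynomial inequalities. *)
Definition rdot x y : R := complex.Re (hdot x y).

Lemma rdotDl x y z : rdot (x + y) z = rdot x z + rdot y z.
Proof. by rewrite /rdot linearDl; exact: Re_addC. Qed.

Lemma rdotC x y : rdot x y = rdot y x.
Proof. by rewrite /rdot hermC expr0 mul1r; exact: Re_conjC. Qed.

Lemma rdotDr x y z : rdot z (x + y) = rdot z x + rdot z y.
Proof. by rewrite !(rdotC z) rdotDl. Qed.

Lemma rdotZl r x y : rdot (r%:C *: x) y = r * rdot x y.
Proof. by rewrite /rdot linearZl_LR; exact: Re_scaleC. Qed.

Lemma rdotZr r x y : rdot x (r%:C *: y) = r * rdot x y.
Proof. by rewrite rdotC rdotZl rdotC. Qed.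

Lemma rdotNl x y : rdot (- x) y = - rdot x y.
Proof. by rewrite /rdot linearNl; exact: Re_oppC. Qed.

Lemma rdotNr x y : rdot x (- y) = - rdot x y.
Proof. by rewrite rdotC rdotNl rdotC. Qed.

Definition rdotE := (rdotDl, rdotDr, rdotZl, rdotZr, rdotNl, rdotNr).

Lemma normE x : `|x| = (hnorm x)%:C.
Proof. by rewrite /hnorm RRe_real // normr_real. Qed.

Lemma hnorm_ge0 x : 0 <= hnorm x.
Proof. by rewrite -lecR -normE normr_ge0. Qed.

Lemma hnorm_sqr x : hnorm x ^+ 2 = rdot x x.
Proof. by rewrite /rdot -hdot_norm normE -rmorphXn. Qed.

Lemma rdot_ge0 x : 0 <= rdot x x.
Proof. by rewrite -hnorm_sqr sqr_ge0. Qed.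

Lemma rdot_eq0 x : rdot x x <= 0 -> x = 0.
Proof.
rewrite -hnorm_sqr => h; apply/eqP; rewrite -normr_eq0 normE.
suff -> : hnorm x = 0 by [].
by apply/eqP; rewrite -sqrf_eq0 eq_le h sqr_ge0.
Qed.

Lemma ler_hnorm_sum n (x : 'I_n -> H) :
  hnorm (\sum_(i < n) x i) <= \sum_(i < n) hnorm (x i).
Proof.
rewrite -lecR -normE rmorph_sum /= (le_trans (ler_norm_sum _ _ _)) //.
by apply: ler_sum => i _; rewrite normE.
Qed.

(** * Linearity and boundedness of operators *)

Lemma bounded_operatorD T x y : bounded_operator T -> T (x + y) = T x + T y.
Proof. by case=> h _; have := h 1 x y; rewrite !scale1r. Qed.

Lemma bounded_operator0 T : bounded_operator T -> T 0 = 0.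
Proof.
by move=> hT; apply: (addIr (T 0)); rewrite -bounded_operatorD // !add0r.
Qed.

Lemma bounded_operatorZ T (k : R[i]) x :
  bounded_operator T -> T (k *: x) = k *: T x.
Proof.
move=> hT; have [h _] := hT; have := h k x 0.
by rewrite addr0 bounded_operator0 // addr0.
Qed.

Lemma bounded_operatorB T x y : bounded_operator T -> T (x - y) = T x - T y.
Proof.
move=> hT; rewrite bounded_operatorD //.
by rewrite -scaleN1r bounded_operatorZ // scaleN1r.
Qed.

Lemma bounded_operator_bound T : bounded_operator T ->
  exists2 M : R, 0 < M & forall x, hnorm (T x) <= M * hnorm x.
Proof.
move=> [lT cT].
pose T' : {linear H -> H} := HB.pack T (GRing.isLinear.Build _ _ _ _ T lT).
have /linear_boundedP : bounded_near T' (nbhs 0).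
  exact/linear_bounded_continuous.
case=> M [Mr hM]; have MR : M = (complex.Re M)%:C by rewrite RRe_real.
(* [M] may be nonpositive and only constants above it are known to be bounds, hence this positive
   one. *)
exists (`|complex.Re M| + 1) => [|x]; first by rewrite ltr_wpDl.
have ltM : complex.Re M < `|complex.Re M| + 1.
  by rewrite (le_lt_trans (ler_norm _)) // ltrDl.
have := hM (`|complex.Re M| + 1)%:C.
rewrite MR ltcR => /(_ ltM x) /=.
by rewrite !normE -rmorphM lecR.
Qed.

(** * Operator matrices on the direct sum [H^n] and their norms *)

Definition l2sqr n (x : 'I_n -> H) : R := \sum_(i < n) rdot (x i) (x i).

Lemma l2sqr_ge0 n (x : 'I_n -> H) : 0 <= l2sqr x.
Proof. by apply: sumr_ge0 => i _; exact: rdot_ge0. Qed.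

Lemma l2norm_sqrt n (x : 'I_n -> H) : l2norm x = Num.sqrt (l2sqr x).
Proof. by congr Num.sqrt; apply: eq_bigr => i _; rewrite hnorm_sqr. Qed.

Lemma l2norm_sqr n (x : 'I_n -> H) : l2norm x ^+ 2 = l2sqr x.
Proof. by rewrite l2norm_sqrt sqr_sqrtr // l2sqr_ge0. Qed.

Lemma l2norm_ge0 n (x : 'I_n -> H) : 0 <= l2norm x.
Proof. exact: sqrtr_ge0. Qed.

Lemma hnorm_le_l2norm n (x : 'I_n -> H) i : hnorm (x i) <= l2norm x.
Proof.
rewrite -(@ler_pXn2r _ 2) ?nnegrE ?hnorm_ge0 ?l2norm_ge0 //.
rewrite l2norm_sqr hnorm_sqr /l2sqr (bigD1 i) //= lerDl.
by apply: sumr_ge0 => j _; exact: rdot_ge0.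
Qed.

(** Each coordinate of [x] has norm at most [l2norm x], so row [i] contributes at most the square of
    its sum of bounds. This makes the set under the [sup] in [mxopnorm] bounded. *)
Lemma mxapp_bound n (a : 'M[H -> H]_n) :
  (forall i j, bounded_operator (a i j)) ->
  exists2 C : R, 0 < C & forall x : 'I_n -> H, l2sqr (mxapp a x) <= C * l2sqr x.
Proof.
move=> ha.
have /choice [M hM] : forall ij : 'I_n * 'I_n, exists M : R, 0 <= M /\
    forall x, hnorm (a ij.1 ij.2 x) <= M * hnorm x.
  move=> [i j]; have [M M0 hM] := bounded_operator_bound (ha i j).
  by exists M; split => //; exact: ltW.
pose S i := \sum_(j < n) M (i, j).
exists (\sum_(i < n) S i ^+ 2 + 1).
  by rewrite ltr_wpDl // sumr_ge0 // => i _; rewrite sqr_ge0.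
move=> x; rewrite mulrDl mul1r ler_wpDr ?l2sqr_ge0 // mulr_suml.
apply: ler_sum => i _; rewrite -hnorm_sqr -l2norm_sqr -exprMn.
have S0 : 0 <= S i by apply: sumr_ge0 => j _; case: (hM (i, j)).
rewrite ler_pXn2r ?nnegrE ?hnorm_ge0 ?mulr_ge0 ?l2norm_ge0 //.
rewrite (le_trans (ler_hnorm_sum _)) // mulr_suml ler_sum // => j _.
have [M0 /(_ (x j)) h] := hM (i, j).
by rewrite (le_trans h) // ler_wpM2l // hnorm_le_l2norm.
Qed.

Lemma mxappZ n (a : 'M[H -> H]_n) (r : R) (x : 'I_n -> H) :
  (forall i j, bounded_operator (a i j)) ->
  mxapp a (r%:C *: x) = r%:C *: mxapp a x.
Proof.
move=> ha; apply/funext => i; rewrite /mxapp !fctE scaler_sumr.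
by apply: eq_bigr => j _; rewrite bounded_operatorZ.
Qed.

Lemma l2sqrZ n r (x : 'I_n -> H) : l2sqr (r%:C *: x) = r ^+ 2 * l2sqr x.
Proof.
rewrite /l2sqr mulr_sumr; apply: eq_bigr => i _.
by rewrite !fctE rdotZl rdotZr mulrA expr2.
Qed.

Lemma mxopnorm_le n (a : 'M[H -> H]_n) (C : R) : 0 <= C ->
  (forall x : 'I_n -> H, l2sqr (mxapp a x) <= C ^+ 2 * l2sqr x) ->
  mxopnorm a <= C.
Proof.
move=> C0 hC; apply: ge_sup => [|_ [x /= x1 <-]].
  exists (l2norm (mxapp a 0)); exists 0 => //=.
  rewrite l2norm_sqrt /l2sqr big1 ?sqrtr0 // => i _.
  by rewrite /rdot linear0l.
rewrite l2norm_sqrt -(ger0_norm C0) -sqrtr_sqr ler_wsqrtr //.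
rewrite (le_trans (hC x)) // ler_piMr ?sqr_ge0 //.
by rewrite -l2norm_sqr expr_le1 // l2norm_ge0.
Qed.

(** The [sup] is over a bounded set, so the inequality holds on the unit ball and scales to nonzero
    [x]; at norm 0, where [x] cannot be normalised, [mxapp_bound] gives it directly. *)
Lemma mxopnorm_bound n (a : 'M[H -> H]_n) (x : 'I_n -> H) :
  (forall i j, bounded_operator (a i j)) ->
  l2norm (mxapp a x) <= mxopnorm a * l2norm x.
Proof.
move=> ha; have [C C0 hC] := mxapp_bound ha.
have [x0|x0] := eqVneq (l2sqr x) 0.
  have := hC x; rewrite x0 mulr0 => h.
  rewrite !l2norm_sqrt x0 sqrtr0 mulr0.
  by rewrite (le_trans (ler_wsqrtr h)) // sqrtr0.
have {}x0 : 0 < l2norm x.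
  by rewrite lt_def l2norm_ge0 andbT -sqrf_eq0 l2norm_sqr.
have hy : l2norm ((l2norm x)^-1%:C *: x) <= 1.
  rewrite l2norm_sqrt l2sqrZ -l2norm_sqr -exprMn mulVf ?lt0r_neq0 //.
  by rewrite expr1n sqrtr1.
have : l2norm (mxapp a ((l2norm x)^-1%:C *: x)) <= mxopnorm a.
  apply: ub_le_sup; last by exists ((l2norm x)^-1%:C *: x).
  exists (Num.sqrt C) => _ [y /= y1 <-].
  rewrite l2norm_sqrt ler_wsqrtr // (le_trans (hC y)) // ler_piMr ?(ltW C0) //.
  by rewrite -l2norm_sqr expr_le1 // l2norm_ge0.
rewrite mxappZ // l2norm_sqrt l2sqrZ sqrtrM ?sqr_ge0 // sqrtr_sqr -l2norm_sqrt.
by rewrite ger0_norm ?invr_ge0 ?l2norm_ge0 // ler_pdivrMl // mulrC.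
Qed.

Lemma opnorm_bound T x :
  bounded_operator T -> hnorm (T x) <= opnorm T * hnorm x.
Proof.
move=> hT; have [C C0 hC] := bounded_operator_bound hT.
have [x0|x0] := eqVneq (hnorm x) 0; first by have := hC x; rewrite x0 !mulr0.
have {}x0 : 0 < hnorm x by rewrite lt_def hnorm_ge0 x0.
have hnormZ y : hnorm ((hnorm x)^-1%:C *: y) = (hnorm x)^-1 * hnorm y.
  apply/eqP; rewrite -(@eqrXn2 _ 2) ?hnorm_ge0 ?mulr_ge0 ?invr_ge0 ?hnorm_ge0 //.
  by rewrite exprMn !hnorm_sqr rdotZl rdotZr mulrA expr2.
have : hnorm (T ((hnorm x)^-1%:C *: x)) <= opnorm T.
  apply: ub_le_sup; last first.
    by exists ((hnorm x)^-1%:C *: x) => //=; rewrite hnormZ mulVf ?lt0r_neq0.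
  exists C => _ [y /= y1 <-]; rewrite (le_trans (hC y)) // ler_piMr //.
  exact: ltW.
by rewrite bounded_operatorZ // hnormZ ler_pdivrMl // mulrC.
Qed.

End HilbertSpace.

(** * Unital completely contractive linear maps on [A] *)

Section CompletelyContractiveProjection.
Variables (R : realType) (H : hilbertType R) (A : set (H -> H)) (e : H -> H).
Variable P : (H -> H) -> (H -> H).
Hypothesis hA : unital_operator_algebra A e.
Hypothesis PA : set_fun A A P.
Hypothesis Plin : linear_on A P.
Hypothesis Punital : P e = e.
Hypothesis Pcc : completely_contractive A P.

Let opA : operator_algebra A := uopalg_opalg hA.
Let Ae : A e := identity_mem (uopalg_identity hA).

Let bd T : A T -> bounded_operator T.
Proof. exact: opalg_bounded. Qed.
Hint Resolve bd : core.

Let memZ (k : R[i]) T : A T -> A (k *: T).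
Proof. exact: opalgZ. Qed.

Let memD S T : A S -> A T -> A (S + T).
Proof. exact: opalgD. Qed.

Let memM S T : A S -> A T -> A (S \o T).
Proof. exact: opalgM. Qed.

Let memP T : A T -> A (P T).
Proof. exact: PA. Qed.

Lemma identity_appl T (x : H) : A T -> e (T x) = T x.
Proof.
by move=> /(identity_mull (uopalg_identity hA))/(congr1 (@^~ x)).
Qed.

Lemma identity_appr T (x : H) : A T -> T (e x) = T x.
Proof.
by move=> /(identity_mulr (uopalg_identity hA))/(congr1 (@^~ x)).
Qed.

Lemma linear_on0 : P 0 = 0.
Proof.
have A0 := opalg0 opA; have := Plin 1 A0 A0; rewrite !scale1r addr0 => h.
by apply: (addIr (P 0)); rewrite add0r -h.
Qed.

Lemma linear_onD S T : A S -> A T -> P (S + T) = P S + P T.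
Proof. by move=> AS AT; have := Plin 1 AS AT; rewrite !scale1r. Qed.

Lemma linear_onZ (k : R[i]) T : A T -> P (k *: T) = k *: P T.
Proof.
move=> AT; have := Plin k AT (opalg0 opA).
by rewrite addr0 linear_on0 addr0.
Qed.

Lemma identity_contractive (x : H) : rdot (e x) (e x) <= rdot x x.
Proof.
have := opnorm_bound x (bd Ae).
rewrite (uopalg_norm1 hA) mul1r => h.
by rewrite -!hnorm_sqr ler_pXn2r ?nnegrE ?hnorm_ge0.
Qed.

(** Complete contractivity in the form used below: a quadratic bound on [a] bounds [mxopnorm a] by
    the root of [C], and the norm of the image gives it back at each vector. *)
Lemma completely_contractive_l2sqr n (a : 'M[H -> H]_n) (C : R) : 0 <= C ->
  (forall i j, A (a i j)) ->
  (forall x : 'I_n -> H, l2sqr (mxapp a x) <= C * l2sqr x) ->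
  forall x : 'I_n -> H, l2sqr (mxapp (map_mx P a) x) <= C * l2sqr x.
Proof.
move=> C0 Aa ha x.
have le_mxopnorm : mxopnorm (map_mx P a) <= Num.sqrt C.
  rewrite (le_trans (Pcc Aa)) // mxopnorm_le ?sqrtr_ge0 // => y.
  by rewrite sqr_sqrtr.
have APa i j : bounded_operator (map_mx P a i j).
  by rewrite mxE; apply/bd/PA.
rewrite -[C]sqr_sqrtr // -!l2norm_sqr -exprMn.
rewrite ler_pXn2r ?nnegrE ?mulr_ge0 ?sqrtr_ge0 ?l2norm_ge0 //.
by rewrite (le_trans (mxopnorm_bound x APa)) // ler_wpM2r ?l2norm_ge0.
Qed.

(** * Numerical ranges of strictly upper triangular 3x3 matrices [U], through [1 + U] *)

Definition utri3 (a b c : H -> H) : 'M[H -> H]_3 := \matrix_(i, j)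
  nth 0 (nth [::] [:: [:: e; a; c]; [:: 0; e; b]; [:: 0; 0; e]] i) j.

Definition vec3 (u v w : H) : 'I_3 -> H := fun i => nth 0 [:: u; v; w] i.

Lemma l2sqr3 (x : 'I_3 -> H) : l2sqr x =
  rdot (x 0) (x 0) + rdot (x 1) (x 1) + rdot (x 2) (x 2).
Proof.
rewrite /l2sqr !big_ord_recl big_ord0 addr0 addrA.
by congr (rdot (x _) (x _) + rdot (x _) (x _) + rdot (x _) (x _));
  apply/val_inj.
Qed.

Lemma l2sqr_utri3 a b c (x : 'I_3 -> H) (u := x 0) (v := x 1) (w := x 2) :
  l2sqr (mxapp (utri3 a b c) x) =
  rdot (e u + (a v + c w)) (e u + (a v + c w)) +
  rdot (e v + b w) (e v + b w) + rdot (e w) (e w).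
Proof.
have E (F : 'I_3 -> H) : \sum_(j < 3) F j = F 0 + F 1 + F 2.
  rewrite !big_ord_recl big_ord0 addr0 addrA.
  by congr (F _ + F _ + F _); apply/val_inj.
have z y : (0 : H -> H) y = 0 by [].
by rewrite l2sqr3 /mxapp !E !mxE /= !z !add0r !addrA.
Qed.

Lemma utri3_mem a b c : A a -> A b -> A c -> forall i j, A (utri3 a b c i j).
Proof.
have A0 := opalg0 opA.
by move=> Aa Ab Ac [[|[|[|//]]] ?] [[|[|[|//]]] ?]; rewrite mxE.
Qed.

Lemma map_utri3 a b c : map_mx P (utri3 a b c) = utri3 (P a) (P b) (P c).
Proof.
apply/matrixP => [[[|[|[|//]]] ?] [[|[|[|//]]] ?]]; rewrite !mxE //=;
  exact: linear_on0.
Qed.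

(* The strictly upper triangular matrix [U] with entries [a], [b], [c] satisfies
   [Re <U v, v> <= |v|^2 / 2] iff [|1 + t U|^2 <= 1 + t + O(t^2)] as [t -> 0+];
   the second condition survives a unital completely contractive map. *)
Lemma completely_contractive_numerical_range a b c : A a -> A b -> A c ->
  (forall u v w, e u = u -> e v = v -> e w = w ->
     2 * (rdot (a v + c w) u + rdot (b w) v) <=
       rdot u u + rdot v v + rdot w w) ->
  forall u v w, e u = u -> e v = v -> e w = w ->
     2 * (rdot (P a v + P c w) u + rdot (P b w) v) <=
       rdot u u + rdot v v + rdot w w.
Proof.
move=> Aa Ab Ac habc u v w eu ev ew.
have sq_le T : A T ->
    exists2 M : R, 0 <= M & forall x, rdot (T x) (T x) <= M * rdot x x.
  move=> AT; have [M M0 hM] := bounded_operator_bound (bd AT).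
  exists (M ^+ 2) => [|x]; first by rewrite sqr_ge0.
  rewrite -!hnorm_sqr -exprMn ler_pXn2r ?nnegrE ?mulr_ge0 ?hnorm_ge0 //.
  exact: ltW.
have [Ma Ma0 hMa] := sq_le a Aa.
have [Mb Mb0 hMb] := sq_le b Ab.
have [Mc Mc0 hMc] := sq_le c Ac.
(* [C] will bound |U|^2, by |a v + c w|^2 <= 2 |a v|^2 + 2 |c w|^2. *)
pose C := 2 * Ma + Mb + 2 * Mc.
have C0 : 0 <= C by rewrite /C; lra.
have dil (t : R) (x p y q z : H) :
    rdot (x + t%:C *: p) (x + t%:C *: p) +
      rdot (y + t%:C *: q) (y + t%:C *: q) + rdot z z =
    rdot x x + rdot y y + rdot z z + t * (2 * (rdot p x + rdot q y)) +
      t ^+ 2 * (rdot p p + rdot q q).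
  by rewrite !rdotE (rdotC x p) (rdotC y q); ring.
have key (t : R) : 0 < t -> 2 * (rdot (P a v + P c w) u + rdot (P b w) v) <=
    (1 + C * t) * (rdot u u + rdot v v + rdot w w).
  move=> t0; have C1 : 0 <= 1 + t + C * t ^+ 2.
    by rewrite !addr_ge0 ?mulr_ge0 ?sqr_ge0 // ltW.
  have bound (x : 'I_3 -> H) :
      l2sqr (mxapp (utri3 (t%:C *: a) (t%:C *: b) (t%:C *: c)) x) <=
        (1 + t + C * t ^+ 2) * l2sqr x.
    rewrite l2sqr_utri3 !fctE.
    (* [habc] concerns only vectors fixed by [e]. As [T \o e = T] for [T] in [A], each coordinate
       can be replaced by its image under [e], whose norm is no larger. *)
    set u' := e (x 0); set v' := e (x 1); set w' := e (x 2).
    have ex y : e (e y) = e y by exact: identity_appl.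
    have -> : a (x 1) = a v' by rewrite identity_appr.
    have -> : b (x 2) = b w' by rewrite identity_appr.
    have -> : c (x 2) = c w' by rewrite identity_appr.
    rewrite -scalerDr dil.
    pose S' := rdot u' u' + rdot v' v' + rdot w' w'.
    have first_order : 2 * (rdot (a v' + c w') u' + rdot (b w') v') <= S'.
      by apply: habc; exact: ex.
    have second_order :
        rdot (a v' + c w') (a v' + c w') + rdot (b w') (b w') <= C * S'.
      have := hMa v'; have := hMb w'; have := hMc w'.
      have := rdot_ge0 (a v' - c w').
      rewrite /C /S' !rdotE (rdotC (c w')).
      have := rdot_ge0 u'; have := rdot_ge0 v'; have := rdot_ge0 w'.
      nra.
    have S'le : S' <= l2sqr x.
      by rewrite l2sqr3 !lerD // identity_contractive.
    rewrite (le_trans _ (ler_wpM2l C1 S'le)) // -/S'.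
    have := ler_wpM2l (ltW t0) first_order.
    have := ler_wpM2l (sqr_ge0 t) second_order.
    move: first_order second_order S'le => _ _ _.
    by move: S' (2 * _) (rdot _ _ + _) => ? ? ? ? ?; lra.
  have mem := utri3_mem (memZ t%:C Aa) (memZ t%:C Ab)
    (memZ t%:C Ac).
  have := completely_contractive_l2sqr C1 mem bound (vec3 u v w).
  rewrite map_utri3 !linear_onZ // l2sqr_utri3 l2sqr3 !fctE /= eu ev ew.
  rewrite -scalerDr dil.
  have := mulr_ge0 (sqr_ge0 t)
    (addr_ge0 (rdot_ge0 (P a v + P c w)) (rdot_ge0 (P b w))).
  move: (2 * _) (t ^+ 2 * _) (rdot u u + _ + _) => D E N.
  by move=> ? ?; rewrite -(ler_pM2l t0); lra.
apply/ler_addgt0Pr => eps eps0.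
set N := rdot u u + _ + _ in key *.
have N0 : 0 <= N by rewrite !addr_ge0 ?rdot_ge0.
have CN0 : 0 <= C * N by rewrite mulr_ge0.
(* This [t] keeps the error C t N below [eps]; the [+ 1] covers C N = 0. *)
have t0 : 0 < eps / (C * N + 1) by rewrite divr_gt0 // ltr_wpDl.
rewrite (le_trans (key _ t0)) // mulrDl mul1r lerD2l mulrAC mulrCA.
rewrite -[leRHS]mulr1 ler_pM2l // ler_pdivrMr ?ltr_wpDl // mul1r.
by rewrite lerDl.
Qed.

(** * Row and column estimates by induction on [k] *)

Lemma row_contractive b x (c := P (b \o x)) (k : nat) :
  A b -> P b = b -> A x -> P x = 0 -> P c = c ->
  (forall v, rdot (b v) (b v) <= rdot v v) ->
  (forall v, rdot (x v) (x v) <= rdot v v) ->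
  forall v w, e v = v -> e w = w ->
    rdot (b v + (Num.sqrt k%:R)%:C *: c w) (b v + (Num.sqrt k%:R)%:C *: c w) <=
      rdot v v + rdot w w.
Proof.
move=> Ab Pb Ax Px Pc b1 x1.
have Abx : A (b \o x) by exact: memM.
have Ac : A c by exact: memP.
have [be bb bc] := And3 (bd Ae) (bd Ab) (bd Ac).
elim: k => [|k IHk] v w ev ew.
  by rewrite sqrtr0 scale0r addr0 ler_wpDr ?rdot_ge0.
set d := Num.sqrt k%:R in IHk; set s := Num.sqrt _.
have d2 : d ^+ 2 = k%:R by rewrite sqr_sqrtr.
have s2 : s ^+ 2 = d ^+ 2 + 1 by rewrite d2 sqr_sqrtr // -natr1.
have s0 : 0 < s by rewrite sqrtr_gt0.
have sV : s * s^-1 = 1 by rewrite divff ?gt_eqF.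
pose g := s^-1%:C *: ((d ^+ 2)%:C *: c + (b \o x)).
pose y := (- s^-1)%:C *: x.
have Ag : A g by apply/memZ/memD => //; exact: memZ.
have Ay : A y by exact: memZ.
(* Here the induction gains one: d^2 c + P (b x) = (d^2 + 1) c = s^2 c. *)
have Pg : P g = s%:C *: c.
  rewrite /g linear_onZ ?linear_onD ?linear_onZ //; last first.
  - by apply: memD => //; exact: memZ.
  - exact: memZ.
  rewrite Pc -/c -{2}[c]scale1r -scalerDl scalerA -(rmorph1 (real_complex R)).
  by rewrite -rmorphD -rmorphM -s2 expr2 mulrA mulVf ?mul1r ?gt_eqF.
have Py : P y = 0 by rewrite linear_onZ // Px scaler0.
have diss u' v' w' : e u' = u' -> e v' = v' -> e w' = w' ->
    2 * (rdot (b v' + g w') u' + rdot (y w') v') <=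
      rdot u' u' + rdot v' v' + rdot w' w'.
  move=> eu' ev' ew'.
  have fixed : e (v' - y w') = v' - y w'.
    by rewrite (bounded_operatorB _ _ be) ev' identity_appl.
  have fixed2 : e ((d * s^-1)%:C *: w') = (d * s^-1)%:C *: w'.
    by rewrite (bounded_operatorZ _ _ be) ew'.
  (* At these vectors the row (b, d c) takes the value b v' + g w'. The square of v' - y w' supplies
     the cross term in [y], and |y w'|^2 <= |w'|^2 / s^2 adds up with (d / s)^2 = 1 - 1 / s^2 to
     |w'|^2. *)
  have := IHk _ _ fixed fixed2.
  have -> : b (v' - y w') + d%:C *: c ((d * s^-1)%:C *: w') = b v' + g w'.
    rewrite (bounded_operatorB _ _ bb) -addrA; congr (_ + _).
    rewrite /y /g !fctE (bounded_operatorZ _ _ bb) (bounded_operatorZ _ _ bc).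
    rewrite -scaleNr -rmorphN opprK.
    rewrite scalerA -rmorphM mulrA -expr2 scalerDr addrC scalerA.
    by rewrite -rmorphM mulrC.
  have : rdot (y w') (y w') <= s^-1 ^+ 2 * rdot w' w'.
    rewrite rdotZl rdotZr mulrA mulrNN -expr2 ler_wpM2l ?sqr_ge0 //.
  have ds1 : (d * s^-1) ^+ 2 = 1 - s^-1 ^+ 2.
    have -> : (d * s^-1) ^+ 2 = (s ^+ 2 - 1) * s^-1 ^+ 2.
      by rewrite s2 addrK exprMn.
    by rewrite mulrBl mul1r -exprMn sV expr1n.
  (* This is 2 Re <p, u'> <= |p|^2 + |u'|^2 for p = b v' + g w'. *)
  have := rdot_ge0 (b v' + g w' - u').
  rewrite (rdotZl (d * s^-1)) (rdotZr (d * s^-1)) mulrA -expr2 ds1.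
  move: (b v' + g w') (y w') => p q.
  rewrite !rdotE (rdotC u') (rdotC v' q).
  by move: (s^-1 ^+ 2) => r *; lra.
have es : e (b v + s%:C *: c w) = b v + s%:C *: c w.
  by rewrite (bounded_operatorD _ _ be) (bounded_operatorZ _ _ be) !identity_appl.
(* At u = b v + s c w, with P y = 0, the left side is 2 |u|^2, so |u|^2 <= |v|^2 + |w|^2. *)
have := completely_contractive_numerical_range Ab Ay Ag diss es ev ew.
rewrite Pb Pg Py !fctE.
have -> : (0 : H -> H) w = 0 by [].
have -> : rdot 0 v = 0 by rewrite /rdot linear0l.
move: (rdot (b v + _) _) => r; lra.
Qed.

(** The step uses the strictly upper triangular matrix with first row x / s, (k c + x b) / s and
    second row - b, where s^2 = k + 1. Its image has entries 0, s c, - b, whose last column carries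
    the next estimate. Here [d] is [k], not its root. *)
Lemma column_contractive b x (c := P (x \o b)) (k : nat) :
  A b -> P b = b -> A x -> P x = 0 -> P c = c ->
  (forall v, rdot (b v) (b v) <= rdot v v) ->
  (forall v, rdot (x v) (x v) <= rdot v v) ->
  forall w, e w = w ->
    rdot (b w) (b w) + k%:R * rdot (c w) (c w) <= rdot w w.
Proof.
move=> Ab Pb Ax Px Pc b1 x1.
have Axb : A (x \o b) by exact: memM.
have Ac : A c by exact: memP.
have [be bx bc] := And3 (bd Ae) (bd Ax) (bd Ac).
elim: k => [|k IHk] w ew; first by rewrite mul0r addr0.
set d : R := k%:R in IHk; set s := Num.sqrt (k.+1%:R : R).
have d0 : 0 <= d by [].
have s2 : s ^+ 2 = d + 1 by rewrite sqr_sqrtr // -natr1.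
have s0 : 0 < s by rewrite sqrtr_gt0.
have sV : s * s^-1 = 1 by rewrite divff ?gt_eqF.
pose g := s^-1%:C *: (d%:C *: c + (x \o b)).
pose y := s^-1%:C *: x.
pose b' := (- 1)%:C *: b.
have Ag : A g by apply/memZ/memD => //; exact: memZ.
have Ay : A y by exact: memZ.
have Ab' : A b' by exact: memZ.
have Pg : P g = s%:C *: c.
  rewrite /g linear_onZ ?linear_onD ?linear_onZ //; last first.
  - by apply: memD => //; exact: memZ.
  - exact: memZ.
  rewrite Pc -/c -{2}[c]scale1r -scalerDl scalerA -(rmorph1 (real_complex R)).
  by rewrite -rmorphD -rmorphM -s2 expr2 mulrA mulVf ?mul1r ?gt_eqF.
have Py : P y = 0 by rewrite linear_onZ // Px scaler0.
have diss u' v' w' : e u' = u' -> e v' = v' -> e w' = w' ->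
    2 * (rdot (y v' + g w') u' + rdot (b' w') v') <=
      rdot u' u' + rdot v' v' + rdot w' w'.
  move=> eu' ev' ew'.
  have -> : y v' + g w' = s^-1%:C *: (x (v' + b w') + d%:C *: c w').
    rewrite /y /g !fctE -scalerDr (bounded_operatorD _ _ bx).
    by rewrite (addrC (d%:C *: _)) addrA.
  have -> : b' w' = - b w' by rewrite /b' !fctE rmorphN rmorph1 scaleN1r.
  have := IHk w' ew'.
  have := x1 (v' + b w').
  move: (c w') (x (v' + b w')) => q p.
  (* Convexity of the square: (d + 1) (|p|^2 + d |q|^2) - |p + d q|^2 = d |p - q|^2. *)
  have : rdot (s^-1%:C *: (p + d%:C *: q)) (s^-1%:C *: (p + d%:C *: q)) <=
      rdot p p + d * rdot q q.
    rewrite rdotZl rdotZr mulrA -expr2 exprVn ler_pdivrMl ?exprn_gt0 // s2.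
    have := mulr_ge0 d0 (rdot_ge0 (p - q)).
    by rewrite !rdotE (rdotC q p) => ?; lra.
  move: (s^-1%:C *: _) => {}p'.
  have := rdot_ge0 (p' - u').
  by rewrite !rdotE (rdotC u') (rdotC (b w') v') => *; lra.
have eu : e (s%:C *: c w) = s%:C *: c w.
  by rewrite (bounded_operatorZ _ _ be) identity_appl.
have ev : e (- b w) = - b w.
  by rewrite -sub0r (bounded_operatorB _ _ be) bounded_operator0 // identity_appl.
(* At u = s c w and v = - b w the left side is 2 (s^2 |c w|^2 + |b w|^2), half of which cancels. *)
have := completely_contractive_numerical_range Ay Ab' Ag diss eu ev ew.
rewrite Pg Py (linear_onZ _ Ab) Pb !fctE rmorphN rmorph1 scaleN1r.
have -> : (0 : H -> H) (- b w) = 0 by [].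
rewrite add0r !rdotE mulrA -expr2 s2 -natr1 -/d.
by move=> *; lra.
Qed.

(** * The kernel of [P] as a bimodule over its fixed points *)

Lemma le0_natmul_bounded (p q : R) : (forall k, k%:R * p <= q) -> p <= 0.
Proof.
move=> h; rewrite leNgt; apply/negP => p0.
have := h (Num.bound `|q / p|); rewrite -ler_pdivlMr // leNgt => /negP; apply.
by rewrite (le_lt_trans (ler_norm _)) // archi_boundP.
Qed.

Lemma eq0_on_fixed T : A T ->
  (forall w, e w = w -> rdot (T w) (T w) <= 0) -> T = 0.
Proof.
move=> AT hT; apply/funext => w; rewrite -(identity_appr w AT).
by apply/rdot_eq0/hT; rewrite identity_appl.
Qed.

(** The bound [M] is strictly positive, even for [T = 0], so its inverse is a nonzero factor. *)
Lemma contractive_multiple T : A T ->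
  exists2 r : R, r != 0 &
    forall v, rdot ((r%:C *: T) v) ((r%:C *: T) v) <= rdot v v.
Proof.
move=> AT; have [M M0 hM] := bounded_operator_bound (bd AT).
exists M^-1; first by rewrite invr_eq0 gt_eqF.
move=> v; rewrite !fctE rdotZl rdotZr mulrA -expr2 exprVn.
rewrite ler_pdivrMl ?exprn_gt0 // -!hnorm_sqr -exprMn.
by rewrite ler_pXn2r ?nnegrE ?mulr_ge0 ?hnorm_ge0 // ltW.
Qed.

Hypothesis Pproj : forall a, A a -> P (P a) = P a.

(** Rescaling makes [b] and [x] contractions and keeps P b = b and P x = 0. The row estimate at v =
    0, and the column estimate without |b w|^2, then give k |c w|^2 <= |w|^2 for every [k]. *)
Lemma kernel_ideal b x : A b -> P b = b -> A x -> P x = 0 ->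
  P (b \o x) = 0 /\ P (x \o b) = 0.
Proof.
move=> Ab Pb Ax Px.
have [r r0 rb] := contractive_multiple Ab.
have [q q0 qx] := contractive_multiple Ax.
have rqE : (r%:C *: b) \o (q%:C *: x) = (r * q)%:C *: (b \o x).
  apply/funext => v; rewrite !fctE (bounded_operatorZ _ _ (bd Ab)).
  by rewrite scalerA -rmorphM.
have qrE : (q%:C *: x) \o (r%:C *: b) = (r * q)%:C *: (x \o b).
  apply/funext => v; rewrite !fctE (bounded_operatorZ _ _ (bd Ax)).
  by rewrite scalerA -rmorphM mulrC.
have rq0 : (r * q)%:C != 0 by rewrite fmorph_eq0 mulf_neq0.
have Prb : P (r%:C *: b) = r%:C *: b by rewrite linear_onZ // Pb.
have Pqx : P (q%:C *: x) = 0 by rewrite linear_onZ // Px scaler0.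
have [Arb Aqx] := conj (memZ r%:C Ab) (memZ q%:C Ax).
have [Abx Axb] := conj (memM Arb Aqx) (memM Aqx Arb).
split; apply: (scalerI rq0); rewrite scaler0 -linear_onZ; try exact: memM.
- rewrite -rqE; apply: eq0_on_fixed; first exact: memP.
  move=> w ew; apply: (@le0_natmul_bounded _ (rdot w w)) => k.
  have := row_contractive k Arb Prb Aqx Pqx (Pproj Abx) rb qx
    (bounded_operator0 (bd Ae)) ew.
  rewrite (bounded_operator0 (bd Arb)) add0r !rdotE mulrA -expr2 sqr_sqrtr //.
  by rewrite (_ : rdot 0 0 = 0) ?add0r // /rdot linear0l.
- rewrite -qrE; apply: eq0_on_fixed; first exact: memP.
  move=> w ew; apply: (@le0_natmul_bounded _ (rdot w w)) => k.
  have := column_contractive k Arb Prb Aqx Pqx (Pproj Axb) rb qx ew.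
  by apply: le_trans; rewrite lerDr rdot_ge0.
Qed.

Lemma linear_onB S T : A S -> A T -> P (S - T) = P S - P T.
Proof.
move=> AS AT; have ANT : A (-1 *: T) by exact: memZ.
by rewrite -scaleN1r linear_onD // linear_onZ // scaleN1r.
Qed.

(** By idempotence [P] kills a - P a, to which [kernel_ideal] applies. *)
Lemma projection_bimodule a b : A a -> A b -> P b = b ->
  P (b \o a) = P (b \o P a) /\ P (a \o b) = P (P a \o b).
Proof.
move=> Aa Ab Pb; have APa := memP Aa.
have Aker : A (a - P a) by rewrite -scaleN1r; apply: memD => //; exact: memZ.
have Pker : P (a - P a) = 0 by rewrite linear_onB // Pproj // subrr.
have [hl hr] := kernel_ideal Ab Pb Aker Pker.
have El : b \o (a - P a) = (b \o a) - (b \o P a).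
  by apply/funext => v; rewrite !fctE (bounded_operatorB _ _ (bd Ab)).
(* On this side composition distributes by computation; on the other it needed the linearity of
   [b]. *)
have Er : (a - P a) \o b = (a \o b) - (P a \o b) by [].
split; apply/subr0_eq; rewrite -linear_onB; try exact: memM.
- by rewrite -El.
- by rewrite -Er.
Qed.

End CompletelyContractiveProjection.

(** * The conditional expectation property *)

Theorem proposition5p1 (R : realType) (H : hilbertType R)
    (A B : set (H -> H)) (e : H -> H) (P : (H -> H) -> (H -> H))
    (hA : unital_operator_algebra A e)
    (hB : unital_subalgebra A e B)
    (PA : set_fun A A P)
    (Plin : linear_on A P)
    (Pproj : forall a, A a -> P (P a) = P a)
    (Ponto : P @` A = B)
    (Punital : P e = e)
    (Pcc : completely_contractive A P) :
  forall a b1 b2, A a -> B b1 -> B b2 ->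
    P (b1 \o a \o b2) = b1 \o P a \o b2.
Proof.
move=> a b1 b2 Aa Bb1 Bb2.
have B_A := usubalg_sub hB.
have PB b : B b -> P b = b by rewrite -Ponto => -[c Ac <-]; exact: Pproj.
have BP c : A c -> B (P c) by move=> Ac; rewrite -Ponto; exists c.
have BM S T : B S -> B T -> B (S \o T).
  by move=> BS BT; exact: (opalgM (usubalg_opalg hB)).
have opA := uopalg_opalg hA.
have bimod := projection_bimodule hA PA Plin Punital Pcc Pproj.
have Ab1a : A (b1 \o a) by apply: (opalgM opA) => //; exact: B_A.
(* [P] is inserted first around [b1 \o a], then around [a]; the products that remain lie in [B],
   where [P] is the identity. *)
have [_ ->] := bimod _ _ Ab1a (B_A _ Bb2) (PB _ Bb2).
have [-> _] := bimod _ _ Aa (B_A _ Bb1) (PB _ Bb1).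
have Bb1Pa : B (b1 \o P a) by apply: BM => //; exact: BP.
by rewrite (PB _ Bb1Pa) PB //; exact: BM.
Qed.
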